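(* Lebesgue-almost everywhere, \[ \lim_{n\to\infty}\frac{\sum_{k=1}^n\mathsf a'_k}{\sum_{k=1}^n\mathsf a_k}=0 . \]
   Context: $I=(0,1]$, $\mathsf a_n(x)$ denotes the $n$-th continued fraction digit of $x\in I$. $\mathbb P$ is the set of primes. The prime digits are $\mathsf a'_n(x):=\mathsf a_n(x)$ if $\mathsf a_n(x)\in\mathbb P$ and $\mathsf a'_n(x):=0$ otherwise. *)

(* Defs.v *)
From HB Require Import structures.
From mathcomp Require Import all_boot all_order all_algebra.
From mathcomp Require Import all_classical all_reals all_analysis.
Set Implicit Arguments. Unset Strict Implicit. Unset Printing Implicit Defensive.
Import Order.TTheory GRing.Theory Num.Theory.
Local Open Scope ring_scope.

(* Gauss map on I = (0,1]: T x = 1/x - floor(1/x).  (With MathComp's convention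
   0^-1 = 0, T 0 = 0; this only matters for rational x, a null set.) *)
Definition gauss {R : realType} (x : R) : R := x^-1 - (Num.floor (x^-1))%:~R.

Definition cf_digit {R : realType} (n : nat) (x : R) : nat :=
  Num.truncn ((iter n.-1 gauss x)^-1).

Definition cf_prime_digit {R : realType} (n : nat) (x : R) : nat :=
  if prime (cf_digit n x) then cf_digit n x else 0%N.

(* Main.v *)
(* On the cylinder of points whose first digits are w, write
   x = (a y + b) / (c y + d) with y the n-th Gauss iterate of x: the next digit
   is m + 1 with relative Lebesgue measure
   (1 + s) / ((m + 1 + s) (m + 2 + s)), where s = c / d lies in [0, 1]. Hence
   digits are almost independent with P(a = m) of order 1 / m^2, and
   supermartingale arguments give Markov and Chernoff bounds for sums of
   functions of the digits. With n = 4^j, all probabilities below are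
   summable in j:
   - a_1 + ... + a_n <= n j / 48 has probability at most exp(- j / 48);
   - by Chebyshev's bound on the number of primes in [4^k, 4^(k+1)), the sum
     of the prime digits < n among the first 4n digits exceeds a constant
     times n sqrt j with probability at most exp(- 2 sqrt j);
   - the square roots of the prime digits >= n among the first 4n digits have
     sum exceeding d sqrt (n j) with probability O(1 / (d j^(3/2))).
   By Borel-Cantelli, almost surely the quotient is O(1 / sqrt j + d^2) for
   4^j <= n < 4^(j+1) and j large, for every d > 0. *)
Require Import Defs.
From HB Require Import structures.
From mathcomp Require Import all_boot all_order all_algebra.
From mathcomp Require Import all_classical all_reals all_analysis.
From mathcomp Require Import ring lra zify.
Set Implicit Arguments. Unset Strict Implicit. Unset Printing Implicit Defensive.
Import Order.TTheory GRing.Theory Num.Theory numFieldNormedType.Exports.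

(** * A Chebyshev bound for primes *)

Lemma prod_primes_dvdn (s : seq nat) m : uniq s -> all prime s ->
  {in s, forall p, p %| m} -> \prod_(p <- s) p %| m.
Proof.
elim: s => [|p s IH] /= ; first by rewrite big_nil dvd1n.
move=> /andP[ps us] /andP[pp aps] sm; rewrite big_cons Gauss_dvd.
  rewrite sm ?mem_head//= IH// => q qs; apply: sm.
  by rewrite inE qs orbT.
rewrite prime_coprime// Euclid_dvd_prod// big_has; apply/negP => /hasP[q qs /=].
by rewrite dvdn_prime2// ?(allP aps)// => /eqP pq; rewrite pq qs in ps.
Qed.

Lemma prime_dvd_fact p n : prime p -> p %| n`! -> p <= n.
Proof.
move=> pp; elim: n => [|n IH]; first by rewrite dvdn1 => /eqP p1; rewrite p1 in pp.
rewrite factS Euclid_dvdM// => /orP[/dvdn_leq->//|/IH]; lia.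
Qed.

(** Being larger than n, the prime divides (2n)! but neither factor n! of the denominator. *)
Lemma prime_dvd_central_bin p n : prime p -> n < p <= n.*2 -> p %| 'C(n.*2, n).
Proof.
move=> pp /andP[np p2n].
have : p %| (n.*2)`! by rewrite dvdn_fact// p2n prime_gt0.
rewrite -(@bin_fact n.*2 n); last by lia.
rewrite (_ : n.*2 - n = n); last by lia.
rewrite !Euclid_dvdM// => /or3P[//||] /(prime_dvd_fact pp); lia.
Qed.

Lemma central_bin_le n : 'C(n.*2, n) <= 2 ^ n.*2.
Proof.
rewrite -[2]/(1 + 1) expnDn.
rewrite (bigD1 (inord n)) //= inordK; last by lia.
by rewrite !exp1n !muln1 leq_addr.
Qed.

Lemma expn_size_le_prod (s : seq nat) m :
  {in s, forall p, m <= p} -> m ^ size s <= \prod_(p <- s) p.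
Proof.
elim: s => [|p s IH] sm; first by rewrite big_nil.
rewrite big_cons expnS leq_mul ?sm ?mem_head// IH// => q qs.
by apply: sm; rewrite inE qs orbT.
Qed.

Lemma primes_dyadic_count l :
  l * (\sum_(2 ^ l <= p < 2 ^ l.+1 | prime p) 1) <= 2 * 2 ^ l.
Proof.
case: l => [|[|l]]; [by rewrite mul0n | by rewrite unlock |].
set L := l.+2; set s := [seq p <- index_iota (2 ^ L) (2 ^ L.+1) | prime p].
have sP p : p \in s -> prime p /\ 2 ^ L < p <= (2 ^ L).*2.
  rewrite mem_filter mem_index_iota => /and3P[pp p1 p2]; split => //.
  rewrite ltn_neqAle p1 andbT; apply/andP; split; last by rewrite -mul2n -expnS ltnW.
  (* [2 ^ L] is even and exceeds 2, so it is not prime; this gives the strict bound that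
     [prime_dvd_central_bin] needs. *)
  apply/eqP => pE; have : 2 %| p by rewrite -pE expnS dvdn_mulr.
  rewrite dvdn_prime2// => /eqP p_2; move: pE; rewrite -p_2 !expnS.
  have := expn_gt0 2 l; lia.
have : (2 ^ L) ^ size s <= 2 ^ (2 ^ L).*2.
  (* The product of the primes in (2^L, 2^(L+1)] divides 'C(2^(L+1), 2^L). *)
  apply: leq_trans (central_bin_le _); apply: (@leq_trans (\prod_(p <- s) p)).
    by apply: expn_size_le_prod => p /sP[_ /andP[/ltnW]].
  apply: dvdn_leq; first by rewrite bin_gt0; lia.
  apply: prod_primes_dvdn; first by rewrite filter_uniq ?iota_uniq.
    exact: filter_all.
  by move=> p /sP[pp pL]; exact: prime_dvd_central_bin.
rewrite -expnM leq_exp2l// -mul2n; apply: leq_trans.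
by rewrite leq_mul2l -sum1_size big_filter leqnn orbT.
Qed.

(** Two dyadic blocks, with exponents 2k and 2k + 1, contribute [4 ^ k] and [2 * 4 ^ k] to the
    bound. *)
Lemma primes_tetradic_count k :
  k * (\sum_(4 ^ k <= p < 4 ^ k.+1 | prime p) 1) <= 3 * 4 ^ k.
Proof.
have H1 := primes_dyadic_count k.*2; have H2 := primes_dyadic_count k.*2.+1.
have E n : 4 ^ n = 2 ^ n.*2 by rewrite -[4]/(2 ^ 2) -expnM mul2n.
rewrite !E doubleS (@big_cat_nat _ _ _ (2 ^ k.*2.+1))/=; last 2 first.
- by rewrite leq_exp2l.
- by rewrite leq_exp2l.
by rewrite mulnDr; move: H1 H2; rewrite (expnS 2 k.*2); nia.
Qed.

Local Open Scope ring_scope.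
Local Open Scope classical_set_scope.

(* Lebesgue outer measure: it is defined on all sets, so that no measurability
   of the digit functions is ever needed. *)
Local Notation "'mu*' A" := ((@wlength _ idfun)^*%mu A) (at level 10, A at level 8).

(** * Sums of functions of the digits *)

Lemma outer_bigcup_le (R : realType) (F : (set R)^nat) (u : nat -> R) (c : R) :
  (forall m, (mu* (F m) <= (u m)%:E)%E) ->
  (forall N, \sum_(m < N) u m <= c) ->
  (mu* (\bigcup_m F m) <= c%:E)%E.
Proof.
move=> Fu uc.
apply: (le_trans (outer_measure_sigma_subadditive (@wlength R idfun)^*%mu F)).
apply: lime_le.
  by apply: is_cvg_nneseries => n _ _; exact: outer_measure_ge0.
near=> N; rewrite big_mkord.
apply: (@le_trans _ _ (\sum_(m < N) (u m)%:E)%E); first by apply: lee_sum => i _; exact: Fu.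
by rewrite sumEFin lee_fin.
Unshelve. all: by end_near. Qed.

Lemma outer_itv_le (R : realType) (a b : R) : a <= b ->
  (mu* [set` `[a, b]%R] <= (b - a)%:E)%E.
Proof.
move=> ab; have e : mu* [set` `[a, b]%R] = if a < b then (b - a)%:E else 0%E.
  by have := @lebesgue_measure_itv R `[a, b]%R; rewrite /= lte_fin.
by rewrite e; case: ifP => // _; rewrite lee_fin subr_ge0.
Qed.

(* Excludes the rationals, where some Gauss iterate is 0, and then all later
   digits are the junk value 0. *)
Definition infinite_cf {R : realType} (x : R) :=
  x <= 1 /\ forall k, 0 < iter k gauss x.

Lemma gauss_ge0 (R : realType) (x : R) : 0 <= gauss x.
Proof. by rewrite /gauss subr_ge0 floor_le. Qed.

Lemma gauss_le1 (R : realType) (x : R) : gauss x <= 1.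
Proof. by rewrite /gauss lerBlDl; have := ltW (floorD1_gt x^-1); rewrite intrD. Qed.

Lemma infinite_cf_iter (R : realType) (x : R) k :
  infinite_cf x -> 0 < iter k gauss x <= 1.
Proof. by case=> x1 x0; rewrite x0/=; case: k => //= k; exact: gauss_le1. Qed.

Lemma inv_digit_gauss (R : realType) (y : R) : 0 < y ->
  y^-1 = (Num.truncn y^-1)%:R + gauss y.
Proof.
move=> y0; have y0' : 0 <= y^-1 by rewrite invr_ge0 ltW.
rewrite /gauss truncn_floor y0' natr_absz ger0_norm; first by rewrite addrC subrK.
by rewrite floor_ge0.
Qed.

(* Relative length, in a cylinder x = (a y + b) / (c y + d) with s = c / d, of
   the subinterval where the next digit is m + 1 (not m). *)
Definition digit_prob {R : realType} (s : R) (m : nat) : R :=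
  (1 + s) / ((m%:R + 1 + s) * (m%:R + 2 + s)).

Lemma digit_prob_ge0 (R : realType) (s : R) m : 0 <= s -> 0 <= digit_prob s m.
Proof.
by move=> s0; rewrite /digit_prob divr_ge0 ?mulr_ge0// ?addr_ge0.
Qed.

(** The sum telescopes: each term is (1 + s)/(m + 1 + s) - (1 + s)/(m + 2 + s). *)
Lemma sum_digit_prob (R : realType) (s : R) N : 0 <= s ->
  \sum_(m < N) digit_prob s m = 1 - (1 + s) / (N%:R + 1 + s).
Proof.
move=> s0; elim: N => [|N IH]; first by rewrite big_ord0; field; lra.
rewrite big_ord_recr/= IH /digit_prob.
have N0 : 0 <= N%:R :> R by [].
by rewrite -natr1; field; apply/andP; split; lra.
Qed.

Lemma sum_digit_prob_le1 (R : realType) (s : R) N : 0 <= s ->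
  \sum_(m < N) digit_prob s m <= 1.
Proof.
by move=> s0; rewrite sum_digit_prob// gerBl divr_ge0// ?addr_ge0.
Qed.

Section supermartingale.
Context {R : realType}.
(** [U n z] is to bound the conditional probability of ending in [bad] from the partial sum [z] with
    [n] digits still to come; [Ustep] is the supermartingale inequality, over finitely many values
    of the next digit. *)
Context (g : nat -> R) (bad : set R) (U : nat -> R -> R)
  (U0 : forall n z, 0 <= U n z)
  (Ubad : forall z, bad z -> 1 <= U 0 z)
  (Ustep : forall n z (s : R) N, 0 <= s <= 1 ->
    \sum_(m < N) digit_prob s m * U n (z + g m.+1) <= U n.+1 z).

(* [z] is the part of the sum contributed by the digits already fixed, and
   [`|a * d - b * c| / (d * (c + d))] is the length of the cylinder. The next
   digit m turns (a, b, c, d) into (b, a + b m, d, c + d m). *)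
Lemma cylinder_supermartingale n k (a b c d z : R) : 0 <= c <= d -> 0 < d ->
  (mu* [set x : R | [/\ infinite_cf x,
        x * (c * iter k gauss x + d) = a * iter k gauss x + b &
        bad (z + \sum_(0 <= i < n) g (cf_digit (k + i).+1 x))]%R]
   <= (`|a * d - b * c| / (d * (c + d)) * U n z)%:E)%E.
Proof.
elim: n k a b c d z => [|n IH] k a b c d z /andP[c0 cd] d0.
  have [bz|nbz] := pselect (bad z); last first.
    rewrite (_ : [set _ | _] = set0) ?outer_measure0 ?lee_fin.
      by rewrite mulr_ge0// divr_ge0// mulr_ge0//; lra.
    by apply/seteqP; split => // x /= [_ _]; rewrite big_geq// addr0.
  apply: (@le_trans _ _ (`|a * d - b * c| / (d * (c + d)))%:E); last first.
    rewrite lee_fin ler_peMr ?Ubad// divr_ge0// mulr_ge0//; lra.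
  have cd0 : 0 < c + d by lra.
  (* The ends of the cylinder are the images of y = 0 and y = 1. *)
  have -> : `|a * d - b * c| / (d * (c + d)) = `|(a + b) / (c + d) - b / d|.
    rewrite -[X in _ / X]gtr0_norm ?mulr_gt0// -normf_div; congr (`| _ |).
    by field; apply/andP; split; lra.
  have E x : infinite_cf x ->
      x * (c * iter k gauss x + d) = a * iter k gauss x + b ->
      exists2 t, 0 <= t <= 1 & x = b / d + t * ((a + b) / (c + d) - b / d).
    move=> /(@infinite_cf_iter _ _ k); set y := iter k gauss x => /andP[y0 y1] xE.
    have cyd : 0 < c * y + d by have := mulr_ge0 c0 (ltW y0); lra.
    exists (y * (c + d) / (c * y + d)).
      have cy := mulr_ge0 c0 (ltW y0).
      apply/andP; split; first by rewrite divr_ge0 ?mulr_ge0//; lra.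
      by rewrite ler_pdivrMr// mul1r; nra.
    have -> : x = (a * y + b) / (c * y + d) by rewrite -xE mulfK//; lra.
    by field; rewrite !lt0r_neq0.
  (* The sign of the determinant decides which end is on the left. *)
  have [ge|lt] := leP (b / d) ((a + b) / (c + d)).
    rewrite ger0_norm ?subr_ge0//.
    apply: (le_trans _ (outer_itv_le ge)).
    apply: le_outer_measure => x /= [ix xE _].
    by have [t t01 ->] := E _ ix xE; rewrite in_itv/=; apply/andP; split; nra.
  rewrite ltr0_norm ?subr_lt0// opprB.
  apply: (le_trans _ (outer_itv_le (ltW lt))).
  apply: le_outer_measure => x /= [ix xE _].
  by have [t t01 ->] := E _ ix xE; rewrite in_itv/=; apply/andP; split; nra.
set L := `|a * d - b * c| / (d * (c + d)).
(* Split by the next digit [m.+1], substituting y = 1 / (m + 1 + y') with y' the next iterate. *)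
pose F m := [set x : R | [/\ infinite_cf x,
  x * (d * iter k.+1 gauss x + (c + d * m.+1%:R))
    = b * iter k.+1 gauss x + (a + b * m.+1%:R) &
  bad (z + g m.+1 + \sum_(0 <= i < n) g (cf_digit (k.+1 + i).+1 x))]].
apply: (@le_trans _ _ (mu* (\bigcup_m F m))).
  apply: le_outer_measure => x /= [ix xE bx].
  have /andP[y0 y1] := infinite_cf_iter k ix.
  have yE := inv_digit_gauss y0.
  have m1 : (0 < Num.truncn (iter k gauss x)^-1)%N.
    by rewrite truncn_gt0 invf_ge1.
  move: bx xE; rewrite big_nat_recl// addn0 /cf_digit/=.
  set y := iter k gauss x in y0 y1 yE m1 *.
  case: (Num.truncn y^-1) m1 yE => // m _ yE bx xE.
  exists m => //; rewrite /F/=; split => //.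
    have : y * (m.+1%:R + gauss y) = 1 by rewrite -yE mulfV// lt0r_neq0.
    rewrite -/y; set y' := gauss y => yy.
    have w0 : m.+1%:R + y' != 0 by rewrite -yE invr_neq0// lt0r_neq0.
    apply: (mulfI (lt0r_neq0 y0)).
    transitivity (x * (c * y + d * (y * (m.+1%:R + y')))); first by ring.
    rewrite yy mulr1 xE.
    transitivity (a * y + b * (y * (m.+1%:R + y'))); last by ring.
    by rewrite yy mulr1.
  rewrite -addrA; move: bx; congr (bad (_ + (_ + _))).
  by apply: eq_bigr => i _; rewrite addSnnS.
apply: (@outer_bigcup_le _ _ (fun m => L * (digit_prob (c / d) m * U n (z + g m.+1)))).
  move=> m; apply: (le_trans (IH _ _ _ _ _ _ _ _)).
  - rewrite ltW//=; have := mulr_ge0 (ltW d0) (ler0n R m).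
    by rewrite -natr1; nra.
  - have := mulr_ge0 (ltW d0) (ler0n R m).
    by rewrite -natr1; nra.
  rewrite lee_fin mulrA ler_wpM2r// /L /digit_prob.
  have dm := mulr_ge0 (ltW d0) (ler0n R m).
  (* The determinant only changes sign, so the ratio of the two lengths is exactly
     [digit_prob (c / d) m]. *)
  have -> : `|b * (c + d * m.+1%:R) - (a + b * m.+1%:R) * d| = `|a * d - b * c|.
    by rewrite -normrN; congr (`| _ |); ring.
  rewrite le_eqVlt; apply/orP; left; apply/eqP.
  have m0 : 0 <= m%:R :> R by [].
  rewrite -!natr1; field; rewrite !lt0r_neq0//; nra.
move=> N; rewrite -mulr_sumr ler_wpM2l//.
  by rewrite /L divr_ge0// mulr_ge0//; lra.
apply: Ustep; rewrite divr_ge0//=; last by rewrite ltW.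
by rewrite ler_pdivrMr// mul1r.
Qed.

Lemma digit_sum_supermartingale n :
  (mu* [set x : R | (infinite_cf x /\ bad (\sum_(1 <= k < n.+1) g (cf_digit k x)))%R]
   <= (U n 0)%:E)%E.
Proof.
(* The identity matrix describes the whole unit interval, of length 1, with x as its own zeroth
   iterate. *)
have := @cylinder_supermartingale n 0 1 0 0 1 0.
rewrite lexx ler01 => /(_ isT ltr01).
rewrite mulr0 subr0 mulr1 add0r mulr1 normr1 divr1 mul1r.
apply: le_trans; apply: le_outer_measure => x /= [ix bx]; split => //; first by ring.
by rewrite add0r; move: bx; rewrite big_add1.
Qed.

End supermartingale.

Lemma digit_sum_markov (R : realType) (g : nat -> R) (kappa theta : R) n :
  0 < theta -> (forall m, 0 <= g m) ->
  (forall (s : R) N, 0 <= s <= 1 -> \sum_(m < N) digit_prob s m * g m.+1 <= kappa) ->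
  (mu* [set x : R | (infinite_cf x /\ theta <= \sum_(1 <= k < n.+1) g (cf_digit k x))%R]
   <= (n%:R * kappa / theta)%:E)%E.
Proof.
move=> t0 g0 gk.
have k0 : 0 <= kappa by have := gk 0 0%N; rewrite big_ord0; apply; rewrite lexx ler01.
rewrite -[n%:R * kappa]add0r -[X in X + _](@normr0 R R).
(* The potential is a bound for the expected final sum, divided by [theta]; the absolute value makes
   it nonnegative for every real z. *)
apply: (@digit_sum_supermartingale R g [set z : R | theta <= z]
  (fun n z => (`|z| + n%:R * kappa) / theta)).
- by move=> p z; rewrite divr_ge0 ?addr_ge0 ?mulr_ge0// ltW.
- by move=> z /= tz; rewrite mul0r addr0 ler_pdivlMr// mul1r (le_trans tz)// ler_norm.
- move=> p z s N s01.
  have s0 : 0 <= s by case/andP: s01.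
  apply: (@le_trans _ _ (\sum_(m < N) (digit_prob s m * ((`|z| + p%:R * kappa) / theta)
     + digit_prob s m * g m.+1 / theta))).
    apply: ler_sum => m _; rewrite -mulrA -mulrDr ler_wpM2l ?digit_prob_ge0//.
    rewrite -mulrDl ler_wpM2r ?invr_ge0 ?(ltW t0)//.
    by rewrite (le_trans (lerD (ler_normD _ _) (lexx _)))// (ger0_norm (g0 _)); lra.
  rewrite big_split/= -!mulr_suml -natr1 (mulrDl _ _ kappa) mul1r addrA (mulrDl _ kappa).
  apply: lerD; last by rewrite ler_wpM2r ?gk// invr_ge0 ltW.
  rewrite ler_piMl ?sum_digit_prob_le1//.
  by rewrite divr_ge0 ?addr_ge0 ?mulr_ge0// ltW.
Qed.

Lemma digit_sum_chernoff (R : realType) (g : nat -> R) (rho theta : R) n :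
  (forall (s : R) N, 0 <= s <= 1 -> \sum_(m < N) digit_prob s m * expR (g m.+1) <= rho) ->
  (mu* [set x : R | (infinite_cf x /\ theta <= \sum_(1 <= k < n.+1) g (cf_digit k x))%R]
   <= (rho ^+ n * expR (- theta))%:E)%E.
Proof.
move=> gr.
have r0 : 0 <= rho by have := gr 0 0%N; rewrite big_ord0; apply; rewrite lexx ler01.
rewrite -[- theta]add0r.
(* Each remaining digit costs one factor [rho], which bounds the conditional mean of exp g. *)
apply: (@digit_sum_supermartingale R g [set z : R | theta <= z]
  (fun n z => rho ^+ n * expR (z - theta))).
- by move=> p z; rewrite mulr_ge0 ?exprn_ge0// expR_ge0.
- by move=> z /= tz; rewrite expr0 mul1r -expR0 ler_expR subr_ge0.
- move=> p z s N s01.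
  rewrite (eq_bigr (fun m : 'I_N =>
    digit_prob s m * expR (g m.+1) * (rho ^+ p * expR (z - theta)))); last first.
    by move=> m _; rewrite (addrAC z) (expRD (z - theta)); ring.
  rewrite -mulr_suml exprS -mulrA ler_wpM2r ?gr//.
  by rewrite mulr_ge0 ?exprn_ge0// expR_ge0.
Qed.

(** * Sums over integers and primes *)

Lemma digit_prob_le (R : realType) (s : R) m : 0 <= s <= 1 ->
  digit_prob s m <= 2 / m.+1%:R ^+ 2.
Proof.
move=> /andP[s0 s1]; rewrite /digit_prob (_ : m.+1%:R = m%:R + 1); last by rewrite natr1.
have m0 : 0 <= m%:R :> R by [].
have mm := mulr_ge0 m0 m0; have ms := mulr_ge0 m0 s0.
have h : 0 < (m%:R + 1) ^+ 2 :> R by nra.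
rewrite ler_pdivrMr ?mulr_gt0//; [|lra|lra].
by rewrite mulrAC ler_pdivlMr//; nra.
Qed.

(** The numerator is at least 1 and the denominator at most (m + 2)(m + 3), which is at most 6 (m +
    1)^2. *)
Lemma digit_prob_ge (R : realType) (s : R) m : 0 <= s <= 1 ->
  1 / (6 * m.+1%:R ^+ 2) <= digit_prob s m.
Proof.
move=> /andP[s0 s1]; rewrite /digit_prob (_ : m.+1%:R = m%:R + 1); last by rewrite natr1.
have m0 : 0 <= m%:R :> R by [].
have mm := mulr_ge0 m0 m0; have ms := mulr_ge0 m0 s0.
have h : 0 < 6 * (m%:R + 1) ^+ 2 :> R by nra.
rewrite ler_pdivlMr ?mulr_gt0//; [|lra|lra].
by rewrite mulrAC ler_pdivrMr//; nra.
Qed.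

(** Passes from the index m of the digit m + 1 to the digit itself, on a range containing the
    support. *)
Lemma sum_ord_le_support (R : realType) (F : nat -> R) N a b :
  (forall m, 0 <= F m) ->
  (forall m, (m < N)%N -> F m.+1 != 0 -> (a <= m.+1 < b)%N) ->
  \sum_(m < N) F m.+1 <= \sum_(a <= m < b) F m.
Proof.
move=> F0 Fab; rewrite -(big_mkord xpredT (fun m => F m.+1)).
rewrite -(big_add1 _ _ 0 N.+1 xpredT F).
rewrite big_nat_cond [leLHS]big_mkcond/= [leRHS]big_nat_cond [leRHS]big_mkcond/=.
set M := maxn N.+1 b.
have -> : \sum_(a <= i < b) (if (a <= i < b)%N && true then F i else 0) =
   \sum_(0 <= i < M) (if (a <= i < b)%N && true then F i else 0).
  rewrite -big_mkcond -[RHS]big_mkcond/= (big_nat_widen _ _ M) ?leq_maxr//.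
  rewrite (big_nat_widenl _ 0)//; apply: eq_bigl => i; lia.
have -> : \sum_(1 <= i < N.+1) (if (0 < i < N.+1)%N && true then F i else 0) =
   \sum_(0 <= i < M) (if (0 < i < N.+1)%N && true then F i else 0).
  rewrite -big_mkcond -[RHS]big_mkcond/= (big_nat_widen _ _ M) ?leq_maxl//.
  rewrite (big_nat_widenl _ 0)//; apply: eq_bigl => i; lia.
apply: ler_sum => i _; rewrite !andbT.
case: ifPn => [iN|_]; last by case: ifP.
case: ifPn => // ab; rewrite le_eqVlt; apply/orP; left.
apply/negPn/negP => Fi; case: i iN Fi ab => // i iN Fi.
by rewrite Fab.
Qed.

(** Each block [4^k, 4^(k+1)) holds at most 3 * 4^k / k primes. *)
Lemma prime_level_sum_le (R : realType) (f c : nat -> R) j K : (0 < j <= K)%N ->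
  (forall k, 0 <= c k) ->
  (forall k m, prime m -> (4 ^ k <= m < 4 ^ k.+1)%N -> f m <= c k) ->
  \sum_(4 ^ j <= m < 4 ^ K | prime m) f m
    <= \sum_(j <= k < K) c k * (3 * 4 ^+ k / k%:R).
Proof.
move=> /andP[j0 jK] c0 fc; elim: K jK => [|K IH] jK; first by lia.
move: jK; rewrite leq_eqVlt => /predU1P[->|]; first by rewrite !big_geq.
rewrite ltnS => jK.
rewrite (@big_cat_nat _ _ _ (4 ^ K))/=; [|by rewrite leq_exp2l..].
rewrite big_nat_recr//=; apply: lerD; first exact: IH.
apply: (@le_trans _ _ (\sum_(4 ^ K <= m < 4 ^ K.+1 | prime m) c K * 1)).
  rewrite big_nat_cond [leRHS]big_nat_cond; apply: ler_sum => m /andP[mK pm].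
  by rewrite mulr1 fc.
rewrite -mulr_sumr ler_wpM2l// ler_pdivlMr; last by rewrite ltr0n; lia.
have := primes_tetradic_count K; rewrite -(ler_nat R) natrM natr_sum.
by rewrite natrM natrX mulrC.
Qed.

(** Each increment of j adds 3 * 4^j terms of size at least 4^-(j+1), hence at least 3/4. *)
Lemma harmonic_tetradic_ge (R : realType) j :
  j%:R / 2 <= \sum_(1 <= m < (4 ^ j).+1) (m%:R : R)^-1.
Proof.
elim: j => [|j IH]; first by rewrite mul0r sumr_ge0// => i _; rewrite invr_ge0.
rewrite (@big_cat_nat _ _ _ (4 ^ j).+1)//=; last by rewrite ltnS leq_exp2l.
rewrite -natr1 mulrDl; apply: lerD => //.
apply: (@le_trans _ _ (\sum_((4 ^ j).+1 <= m < (4 ^ j.+1).+1) ((4 ^ j.+1)%:R : R)^-1)).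
  have p0 : 0 < (4 ^ j)%:R :> R by rewrite ltr0n expn_gt0.
  rewrite sumr_const_nat subSS expnS.
  rewrite (_ : (4 * 4 ^ j - 4 ^ j = 3 * 4 ^ j)%N); last by lia.
  rewrite -[leRHS]mulr_natr !natrM.
  rewrite (_ : _^-1 * _ = 3 / 4 :> R); last by field; rewrite lt0r_neq0.
  lra.
apply: ler_sum_nat => m /andP[m1 m2].
by rewrite lef_pV2 ?posrE ?ltr0n ?expn_gt0 ?ler_nat//; lia.
Qed.

(** A square root in place of the logarithm is crude, but still of smaller order than the j in the
    lower bound for the digit sum. Induction uses 1/(j + 1) <= 2 (sqrt (j + 1) - sqrt j). *)
Lemma harmonic_le_sqrt (R : realType) j :
  \sum_(1 <= k < j.+1) (k%:R : R)^-1 <= 2 * Num.sqrt j%:R.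
Proof.
elim: j => [|j IH]; first by rewrite big_geq// mulr_ge0// sqrtr_ge0.
rewrite big_nat_recr//=; apply: (le_trans (lerD IH (lexx _))).
set a := Num.sqrt j%:R; set b := Num.sqrt j.+1%:R.
have a0 : 0 <= a by rewrite sqrtr_ge0.
have b0 : 0 < b by rewrite sqrtr_gt0.
have aE : a ^+ 2 = j%:R by rewrite sqr_sqrtr.
have bE : b ^+ 2 = j.+1%:R by rewrite sqr_sqrtr.
have abE : (b - a) * (b + a) = 1.
  by rewrite -subr_sqr aE bE -natr1; ring.
have ab : a <= b by rewrite /a /b ler_wsqrtr// ler_nat.
rewrite -bE; have : (b ^+ 2)^-1 * b ^+ 2 = 1 by rewrite mulVf// lt0r_neq0// exprn_gt0.
have : 0 <= (b ^+ 2)^-1 by rewrite invr_ge0 exprn_ge0// ltW.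
have b1 : 1 <= b ^+ 2 by rewrite bE ler1n.
set w := (b ^+ 2)^-1 => w0 wb.
have : w <= (b - a) * 2; last by lra.
have bb : 1 <= b by nra.
have : w * b <= 1 by nra.
nra.
Qed.

Lemma sum_inv_x32_le (R : realType) N :
  \sum_(1 <= k < N.+1) (k%:R * Num.sqrt k%:R : R)^-1 <= 3.
Proof.
case: N => [|N]; first by rewrite big_geq.
(* The remainder makes the induction telescope: (k + 1)^(-3/2) <= 2 / sqrt k - 2 / sqrt (k + 1). *)
suff : \sum_(1 <= k < N.+2) (k%:R * Num.sqrt k%:R : R)^-1 <= 3 - 2 / Num.sqrt N.+1%:R.
  by move/le_trans; apply; rewrite gerBl divr_ge0// sqrtr_ge0.
elim: N => [|N IH]; first by rewrite big_nat1 sqrtr1 mulr1 invr1; lra.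
rewrite big_nat_recr//=; apply: (le_trans (lerD IH (lexx _))).
set a := Num.sqrt N.+1%:R; set b := Num.sqrt N.+2%:R.
have a0 : 0 < a by rewrite sqrtr_gt0.
have b0 : 0 < b by rewrite sqrtr_gt0.
have bE : N.+2%:R = b ^+ 2 by rewrite sqr_sqrtr.
have aE : N.+1%:R = a ^+ 2 by rewrite sqr_sqrtr.
have abE : (b - a) * (b + a) = 1.
  by rewrite -subr_sqr -aE -bE -[in X in X - _]natr1; ring.
have ab : a <= b by rewrite /a /b ler_wsqrtr// ler_nat.
rewrite bE.
have -> : (b ^+ 2 * b)^-1 = (b - a) * (b + a) / b ^+ 3 by rewrite abE; field; lra.
suff : 0 <= 2 / a - 2 / b - (b - a) * (b + a) / b ^+ 3 by lra.
have -> : 2 / a - 2 / b - (b - a) * (b + a) / b ^+ 3 =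
  (b - a) * (2 * b ^+ 2 - a * (b + a)) / (a * b ^+ 3) by field; rewrite !lt0r_neq0.
rewrite divr_ge0 ?mulr_ge0 ?exprn_ge0//; nra.
Qed.

(** * Tail bounds at scale 4^j *)

Lemma expRN_le (R : realType) (u : R) : 0 <= u <= 1 -> expR (- u) <= 1 - u / 2.
Proof.
move=> /andP[u0 u1]; rewrite expRN -[leLHS]mul1r ler_pdivrMr ?expR_gt0//.
by have := expR_ge1Dx u; nra.
Qed.

Lemma expR_le (R : realType) (v : R) : 0 <= v <= 1 / 2 -> expR v <= 1 + 2 * v.
Proof.
move=> /andP[v0 v1]; rewrite -[v in expR v]opprK expRN -[leLHS]mul1r.
rewrite ler_pdivrMr ?expR_gt0//.
by have := expR_ge1Dx (- v); nra.
Qed.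

Lemma digit_sum_lower_tail (R : realType) j :
  (mu* [set x : R | (infinite_cf x /\
     \sum_(1 <= k < (4 ^ j).+1) (cf_digit k x)%:R <= (4 ^ j)%:R * (j%:R / 48) :> R)%R]
   <= (expR (- (j%:R / 48)))%:E)%E.
Proof.
set M : R := (4 ^ j)%:R; have M0 : 0 < M by rewrite ltr0n expn_gt0.
(* Digits above 4^j are dropped and the rest scaled into [0, 1], where [expRN_le] applies. *)
pose u (m : nat) : R := if (m <= 4 ^ j)%N then m%:R / M else 0.
have u01 m : 0 <= u m <= 1.
  rewrite /u; case: ifP => [mM|_]; last by rewrite lexx ler01.
  by rewrite divr_ge0 ?(ltW M0)//= ler_pdivrMr// mul1r ler_nat.
have um m : u m * M <= m%:R.
  by rewrite /u; case: ifP => _; rewrite ?mul0r// mulfVK// lt0r_neq0.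
(* The mean of [u] is at least (1/6)(j/2)/M, and [expRN_le] halves it, whence j / (24 M) per digit.
   Over M digits this is j/24, of which the threshold spends half. *)
have := @digit_sum_chernoff R (fun m => - u m) (expR (- (j%:R / 24 / M)))
  (- (j%:R / 48)) (4 ^ j).
rewrite -expRM_natl -expRD opprK.
rewrite (_ : _ + _ = - (j%:R / 48)); last by rewrite -/M; field; rewrite lt0r_neq0.
move=> H; apply: (le_trans _ (H _)).
  apply: le_outer_measure => x /= [ix xS]; split => //.
  rewrite sumrN lerN2 -(ler_pM2l M0); apply: le_trans xS.
  by rewrite mulr_sumr; apply: ler_sum => k _; rewrite mulrC.
move=> s N s01 {H}; have /andP[s0 s1] := s01.
(* The sum is extended to at least 4^j terms, all of which the lower bound on the mean of [u]
   requires. *)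
apply: (@le_trans _ _ (\sum_(m < 4 ^ j + N) digit_prob s m * expR (- u m.+1))).
  rewrite addnC big_split_ord/= lerDl sumr_ge0// => m _.
  by rewrite mulr_ge0 ?expR_ge0// digit_prob_ge0.
apply: (@le_trans _ _ (\sum_(m < 4 ^ j + N)
    (digit_prob s m - digit_prob s m * u m.+1 / 2))).
  apply: ler_sum => m _; rewrite (_ : _ - _ = digit_prob s m * (1 - u m.+1 / 2)).
    by rewrite ler_wpM2l ?digit_prob_ge0// expRN_le.
  by ring.
rewrite sumrB -mulr_suml.
apply: (@le_trans _ _ (1 - j%:R / 24 / M)); last exact: expR_ge1Dx.
apply: lerB; first exact: sum_digit_prob_le1.
rewrite big_split_ord/=.
apply: (@le_trans _ _ ((\sum_(m < 4 ^ j) digit_prob s m * u m.+1) / 2)); last first.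
  rewrite ler_wpM2r// lerDl sumr_ge0// => m _.
  by rewrite mulr_ge0 ?digit_prob_ge0//; case/andP: (u01 (4 ^ j + m).+1).
apply: (@le_trans _ _ ((6 * M)^-1 * (j%:R / 2) / 2)).
  by rewrite le_eqVlt; apply/orP; left; apply/eqP; field; rewrite lt0r_neq0.
rewrite ler_wpM2r//.
apply: (@le_trans _ _ ((6 * M)^-1 * \sum_(1 <= m < (4 ^ j).+1) (m%:R : R)^-1)).
  by rewrite ler_wpM2l ?harmonic_tetradic_ge// invr_ge0 mulr_ge0// ltW.
rewrite big_add1/= big_mkord mulr_sumr; apply: ler_sum => m _.
apply: le_trans (_ : 1 / (6 * m.+1%:R ^+ 2) * u m.+1 <= _).
  rewrite /u ltn_ord le_eqVlt; apply/orP; left; apply/eqP.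
  by field; rewrite !lt0r_neq0.
by rewrite ler_wpM2r ?digit_prob_ge//; case/andP: (u01 m.+1).
Qed.

(** The primes 2 and 3 account for the 1; level k >= 1 adds at most 3/k, and [harmonic_le_sqrt] sums
    these. *)
Lemma sum_inv_primes_le (R : realType) j : (0 < j)%N ->
  \sum_(0 <= p < 4 ^ j | prime p) (p%:R : R)^-1 <= 1 + 6 * Num.sqrt j%:R.
Proof.
move=> j0; rewrite (@big_cat_nat _ _ _ 4)//=; last by rewrite -{1}(expn1 4) leq_exp2l.
apply: lerD; first by rewrite unlock/= addr0; lra.
apply: (le_trans (@prime_level_sum_le R _ (fun k => (4 ^+ k)^-1) 1 j _ _ _)).
- by rewrite j0.
- by move=> k; rewrite invr_ge0 exprn_ge0.
- move=> k m pm /andP[km _]; rewrite -natrX lef_pV2 ?posrE ?ltr0n ?expn_gt0 ?(prime_gt0 pm)//.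
  by rewrite ler_nat.
apply: (@le_trans _ _ (\sum_(1 <= k < j.+1) 3 * (k%:R : R)^-1)).
  rewrite big_nat_recr//= -[leLHS]addr0; apply: lerD; last by rewrite mulr_ge0.
  rewrite le_eqVlt; apply/orP; left; apply/eqP.
  apply: eq_big_nat => k /andP[k1 _]; field.
  by rewrite pnatr_eq0 -lt0n k1/= expf_neq0.
by rewrite -mulr_sumr; have := harmonic_le_sqrt R j; lra.
Qed.

Lemma small_prime_digit_sum_tail (R : realType) j : (0 < j)%N ->
  (mu* [set x : R | (infinite_cf x /\
     2 * (4 ^ j)%:R * (8 + 50 * Num.sqrt j%:R) <= \sum_(1 <= k < (4 ^ j.+1).+1)
       (if prime (cf_digit k x) && (cf_digit k x < 4 ^ j)%N then (cf_digit k x)%:R else 0) :> R)%R]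
   <= (expR (- (2 * Num.sqrt j%:R)))%:E)%E.
Proof.
move=> j0; set M : R := (4 ^ j)%:R; have M0 : 0 < M by rewrite ltr0n expn_gt0.
set r := Num.sqrt j%:R.
pose v (m : nat) : R := if prime m && (m < 4 ^ j)%N then m%:R / (2 * M) else 0.
have v01 m : 0 <= v m <= 1 / 2.
  rewrite /v; case: ifP => [/andP[_ mM]|_]; last lra.
  rewrite divr_ge0 ?mulr_ge0 ?(ltW M0)//= ler_pdivrMr ?mulr_gt0//.
  by rewrite (_ : 1 / 2 * (2 * M) = M); [rewrite ler_nat ltnW | field].
(* The mean of [v] is at most (1 + 6 r) / M and [expR_le] doubles it. Over 4M digits the exponent is
   8 + 48 r, so the threshold 8 + 50 r leaves - 2 r. *)
have := @digit_sum_chernoff R v (expR (2 * (1 + 6 * r) / M)) (8 + 50 * r) (4 ^ j.+1).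
rewrite -expRM_natl -expRD.
rewrite (_ : (4 ^ j.+1)%:R * _ - _ = - (2 * r)); last first.
  by rewrite expnS natrM -/M; field; rewrite lt0r_neq0.
move=> H; apply: (le_trans _ (H _)).
  apply: le_outer_measure => x /= [ix xS]; split => //.
  have M20 : 0 < 2 * M by rewrite mulr_gt0.
  rewrite -(ler_pM2l M20); apply: (le_trans xS).
  rewrite mulr_sumr; apply: ler_sum => k _; rewrite /v.
  by case: ifP => _; rewrite ?mulr0// mulrC mulfVK// lt0r_neq0.
move=> s N s01 {H}; have /andP[s0 s1] := s01.
apply: le_trans (expR_ge1Dx _).
apply: (@le_trans _ _ (\sum_(m < N)
    (digit_prob s m + 2 * (digit_prob s m * v m.+1)))).
  apply: ler_sum => m _; rewrite (_ : _ + _ = digit_prob s m * (1 + 2 * v m.+1)).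
    by rewrite ler_wpM2l ?digit_prob_ge0// expR_le.
  by ring.
rewrite big_split/= -[X in _ + X]mulr_sumr; apply: lerD; first exact: sum_digit_prob_le1.
rewrite -mulrA ler_wpM2l//.
apply: (@le_trans _ _ (\sum_(m < N) 2 / m.+1%:R ^+ 2 * v m.+1)).
  by apply: ler_sum => m _; rewrite ler_wpM2r ?digit_prob_le//; case/andP: (v01 m.+1).
apply: (@le_trans _ _ (\sum_(0 <= m < 4 ^ j) 2 / m%:R ^+ 2 * v m)).
  apply: (@sum_ord_le_support R (fun m => 2 / m%:R ^+ 2 * v m)) => [m|m _].
    by rewrite mulr_ge0 ?divr_ge0 ?exprn_ge0//; case/andP: (v01 m).
  by rewrite /v; case: ifP => [/andP[_ ->]//|_]; rewrite mulr0 eqxx.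
rewrite ler_pdivlMr//; apply: le_trans (sum_inv_primes_le R j0).
rewrite mulr_suml [leRHS]big_mkcond/=; apply: ler_sum => m _; rewrite /v.
case: ifPn => [/andP[pm _]|_]; last first.
  by rewrite mulr0 mul0r; case: ifP.
rewrite pm le_eqVlt; apply/orP; left; apply/eqP; field.
by rewrite pnatr_eq0 -lt0n prime_gt0// lt0r_neq0.
Qed.

(* A power of 2 playing the role of sqrt m: within a factor 2 of it, and
   constant on each block [4^k, 4^(k+1)). *)
Definition large_prime_root (j m : nat) : nat :=
  if prime m && (4 ^ j <= m)%N then (2 ^ (trunc_log 4 m).+1)%N else 0%N.

Lemma large_prime_root_sqr j m : prime m -> (4 ^ j <= m)%N ->
  (m <= large_prime_root j m ^ 2)%N.
Proof.
move=> pm jm; rewrite /large_prime_root pm jm /=.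
have /andP[_ /ltnW] := @trunc_log_bounds 4 m isT (prime_gt0 pm).
by rewrite -expnM mulnC expnM.
Qed.

(** Prime digits have infinite mean, since the sum of 1/p diverges; their square roots have finite
    mean, so Markov's bound applies to them. *)
Lemma large_prime_root_sum_tail (R : realType) j (b : R) : (0 < j)%N -> 0 < b ->
  (mu* [set x : R | (infinite_cf x /\
     (2 ^ j)%:R * b <= \sum_(1 <= k < (4 ^ j.+1).+1)
       (large_prime_root j (cf_digit k x))%:R :> R)%R]
   <= (96 / (j%:R * b))%:E)%E.
Proof.
move=> j0 b0; have jR : 0 < j%:R :> R by rewrite ltr0n.
have P0 : 0 < (2 ^ j)%:R :> R by rewrite ltr0n expn_gt0.
have := @digit_sum_markov R (fun m => (large_prime_root j m)%:R)
  (24 / (j%:R * (2 ^ j)%:R)) ((2 ^ j)%:R * b) (4 ^ j.+1).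
rewrite (_ : _ * _ / _ = 96 / (j%:R * b)); last first.
  rewrite expnS natrM -[4%N]/((2 ^ 2)%N) -expnM mulnC expnM natrX.
  by field; rewrite !lt0r_neq0.
move=> H; apply: H => //; first by rewrite mulr_gt0.
move=> s N s01; have /andP[s0 s1] := s01.
apply: (@le_trans _ _ (\sum_(m < N) 2 / m.+1%:R ^+ 2 * (large_prime_root j m.+1)%:R)).
  by apply: ler_sum => m _; rewrite ler_wpM2r ?digit_prob_le.
set F := fun m : nat => 2 / m%:R ^+ 2 * (large_prime_root j m)%:R : R.
apply: (@le_trans _ _ (\sum_(4 ^ j <= m < 4 ^ (j + N)) F m)).
  apply: (@sum_ord_le_support R F) => [m|m mN].
    by rewrite mulr_ge0 ?divr_ge0 ?exprn_ge0.
  rewrite /F /large_prime_root; case: ifP => [/andP[_ ->] _/=|_]; last by rewrite mulr0 eqxx.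
  apply: (leq_ltn_trans mN); apply: (@leq_trans (4 ^ N)); first exact: ltn_expl.
  by rewrite leq_exp2l// leq_addl.
apply: (@le_trans _ _ (\sum_(4 ^ j <= m < 4 ^ (j + N) | prime m) F m)).
  rewrite [leRHS]big_mkcond; apply: ler_sum => m _.
  by case: ifP => // pm; rewrite /F /large_prime_root pm mulr0.
(* Level k contributes at most 12 / (k 2^k); bounding 1/k by 1/j leaves a geometric sum. *)
apply: (le_trans (@prime_level_sum_le R F (fun k => 2 / 16 ^+ k * 2 ^+ k.+1) j (j + N) _ _ _)).
- by rewrite j0 leq_addr.
- by move=> k; rewrite mulr_ge0 ?divr_ge0 ?exprn_ge0.
- move=> k m pm /andP[km mk]; rewrite /F /large_prime_root pm/=.
  rewrite (@trunc_log_eq 4 k m)// ?km//.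
  case: ifP => _; last by rewrite mulr0 mulr_ge0 ?divr_ge0 ?exprn_ge0.
  rewrite natrX ler_wpM2r ?exprn_ge0// ler_wpM2l//.
  rewrite lef_pV2 ?posrE ?exprn_gt0 ?ltr0n ?(prime_gt0 pm)//.
  by rewrite -!natrX ler_nat -[16%N]/((4 ^ 2)%N) -expnM mulnC expnM leq_exp2r.
apply: (@le_trans _ _ (\sum_(j <= k < j + N) 12 / j%:R * (2 ^+ k)^-1)).
  apply: ler_sum_nat => k /andP[jk _].
  have k0 : 0 < k%:R :> R by rewrite ltr0n; lia.
  rewrite (_ : (16 : R) ^+ k = (2 ^+ k) ^+ 4); last first.
    by rewrite -exprM mulnC exprM; congr (_ ^+ _); ring.
  rewrite (_ : (4 : R) ^+ k = (2 ^+ k) ^+ 2); last first.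
    by rewrite -exprM mulnC exprM; congr (_ ^+ _); ring.
  have pk : 0 < (2 : R) ^+ k by rewrite exprn_gt0.
  rewrite (_ : _ * (3 * _ / _) = 12 / k%:R * (2 ^+ k)^-1); last first.
    by rewrite (exprS 2 k); field; rewrite !lt0r_neq0.
  rewrite ler_wpM2r ?invr_ge0 ?(ltW pk)// ler_wpM2l// lef_pV2 ?posrE//.
  by rewrite ler_nat.
rewrite -mulr_sumr (_ : 24 / _ = 12 / j%:R * (2 / (2 ^ j)%:R)); last first.
  by field; rewrite !lt0r_neq0.
rewrite ler_wpM2l ?divr_ge0//.
suff : \sum_(j <= k < j + N) ((2 : R) ^+ k)^-1 <= 2 / (2 ^ j)%:R - 2 / 2 ^+ (j + N).
  by move=> /le_trans; apply; rewrite gerBl divr_ge0// exprn_ge0.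
elim: N {F} => [|N IH]; first by rewrite addn0 big_geq// natrX subrr.
rewrite addnS big_nat_recr ?leq_addr//= exprS.
apply: (le_trans (lerD IH (lexx _))).
have pk : 0 < (2 : R) ^+ (j + N) by rewrite exprn_gt0.
rewrite le_eqVlt; apply/orP; left; apply/eqP; field.
by rewrite !lt0r_neq0.
Qed.

(** * Almost sure convergence *)

(** The limsup set lies in every tail union, bounded by a tail of a convergent series; subadditivity
    suffices. *)
Lemma outer_borel_cantelli (R : realType) (F : (set R)^nat) (u : nat -> R) (c : R) :
  (forall j, (mu* (F j) <= (u j)%:E)%E) -> (forall j, 0 <= u j) ->
  (forall N, \sum_(j < N) u j <= c) ->
  mu* [set x | forall J, exists2 j, (J <= j)%N & F j x] = 0%E.
Proof.
move=> Fu u0 uc; apply/eqP; rewrite eq_le outer_measure_ge0 andbT.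
set Z := [set x | _].
have tail : (fun J => \sum_(J <= j <oo) (u j)%:E)%E @ \oo --> 0%E.
  apply: nneseries_tail_cvg => [|j _]; last by rewrite lee_fin u0.
  apply: (@le_lt_trans _ _ c%:E); last by rewrite ltry.
  apply: lime_le; first by apply: is_cvg_nneseries => j _ _; rewrite lee_fin u0.
  by near=> N; rewrite big_mkord sumEFin lee_fin uc.
rewrite -(cvg_lim _ tail)//; apply: lime_ge; first by apply/cvg_ex; exists 0%E.
near=> J.
apply: (@le_trans _ _ (\sum_(J <= j <oo) mu* (F j))%E); last first.
  by apply: lee_nneseries => // j _ _; exact: outer_measure_ge0.
apply: le_trans (outer_measure_sigma_subadditive_tail (@wlength R idfun)^*%mu J F).
apply: le_outer_measure => x /(_ J)[j Jj Fx].
by exists j => //=; apply/negP; rewrite -leqNgt.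
Unshelve. all: by end_near. Qed.

(** Rationality pulls back along the Gauss map, as 1/x differs from [gauss x] by an integer. *)
Lemma gauss_iter0_rat (R : realType) k (x : R) :
  iter k gauss x = 0 -> range (@ratr R) x.
Proof.
elim: k x => [|k IH] x; first by move=> /= ->; exists 0 => //; rewrite rmorph0.
rewrite iterSr => /IH[q _ qE]; exists ((q + (Num.floor x^-1)%:~R)^-1) => //.
by rewrite fmorphV rmorphD/= ratr_int qE /gauss subrK invrK.
Qed.

Lemma not_infinite_cf_rat (R : realType) (x : R) :
  0 < x <= 1 -> ~ infinite_cf x -> range (@ratr R) x.
Proof.
move=> /andP[x0 x1] nx; apply: contrapT => nrat; apply: nx; split => // k.
have : iter k gauss x != 0 by apply/eqP => /gauss_iter0_rat.
by case: k => // k; rewrite lt0r => -> /=; exact: gauss_ge0.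
Qed.

(** To serve all n in [4^j, 4^(j+1)) by monotonicity, the denominator is controlled at 4^j digits
    and the numerator at 4^(j+1). *)
Definition exceptional {R : realType} (d : R) (j : nat) : set R :=
  [set x : R | infinite_cf x /\
    \sum_(1 <= k < (4 ^ j).+1) (cf_digit k x)%:R <= (4 ^ j)%:R * (j%:R / 48) :> R] `|`
  [set x : R | infinite_cf x /\
    2 * (4 ^ j)%:R * (8 + 50 * Num.sqrt j%:R) <= \sum_(1 <= k < (4 ^ j.+1).+1)
      (if prime (cf_digit k x) && (cf_digit k x < 4 ^ j)%N then (cf_digit k x)%:R else 0) :> R] `|`
  [set x : R | infinite_cf x /\
     (2 ^ j)%:R * (d * Num.sqrt j%:R) <= \sum_(1 <= k < (4 ^ j.+1).+1)
       (large_prime_root j (cf_digit k x))%:R :> R].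

Lemma expRN_le_inv_sqr (R : realType) (t : R) : 0 < t -> expR (- t) <= 4 / t ^+ 2.
Proof.
move=> t0; have := expR_ge1Dx (t / 2) => h.
have -> : - t = - (t / 2) + - (t / 2) by lra.
rewrite expRD expRN ler_pdivlMr ?exprn_gt0//.
have e0 := expR_gt0 (t / 2); set e := expR (t / 2) in h e0 *.
have -> : e^-1 * e^-1 * t ^+ 2 = t ^+ 2 / e ^+ 2 by field; rewrite lt0r_neq0.
by rewrite ler_pdivrMr ?exprn_gt0//; nra.
Qed.

Lemma exceptional_le (R : realType) (d : R) j : (0 < j)%N -> 0 < d ->
  (mu* (exceptional d j) <=
    ((96 ^+ 2 + 16 + 96 / d) * (j%:R * Num.sqrt j%:R)^-1)%:E)%E.
Proof.
move=> j0 d0; have jR : 1 <= j%:R :> R by rewrite ler1n.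
set r := Num.sqrt j%:R.
have rE : j%:R = r ^+ 2 by rewrite sqr_sqrtr.
have r0 : 0 < r by rewrite sqrtr_gt0 ltr0n.
have r1 : 1 <= r by rewrite rE in jR; nra.
have r30 : 0 < r ^+ 3 by rewrite exprn_gt0.
have le_inv (C : R) : 0 <= C -> C / r ^+ 4 <= C / (j%:R * r).
  move=> C0; rewrite rE -exprSr ler_wpM2l// lef_pV2 ?posrE ?exprn_gt0//.
  by rewrite ler_weXn2l.
have e1 : expR (- (j%:R / 48)) <= 96 ^+ 2 / (j%:R * r).
  apply: (le_trans (expRN_le_inv_sqr _)); first by rewrite divr_gt0//; lra.
  apply: le_trans (le_inv _ (sqr_ge0 _)); rewrite rE le_eqVlt.
  by apply/orP; left; apply/eqP; field; rewrite lt0r_neq0.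
(* One use of [expRN_le_inv_sqr] would give only 1/j, which is not summable; squaring the bound for
   exp(- r) gives 1/j^2. *)
have e2 : expR (- (2 * r)) <= 16 / (j%:R * r).
  rewrite (_ : - (2 * r) = - r + - r); last by ring.
  rewrite expRD; apply: (@le_trans _ _ (4 / r ^+ 2 * (4 / r ^+ 2))).
    by rewrite ler_pM ?expR_ge0 ?expRN_le_inv_sqr.
  rewrite (_ : 4 / _ * _ = 16 / r ^+ 4); last by field; rewrite lt0r_neq0.
  exact: le_inv.
apply: (le_trans (outer_measureU2 _ _ _)).
apply: (le_trans (leeD (outer_measureU2 _ _ _) (lexx _))).
apply: (le_trans (leeD (leeD (digit_sum_lower_tail R j)
  (small_prime_digit_sum_tail R j0)) (large_prime_root_sum_tail j0 (mulr_gt0 d0 r0)))).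
rewrite -!EFinD lee_fin (mulrDl (96 ^+ 2 + 16) (96 / d)); apply: lerD.
  apply: (le_trans (lerD e1 e2)); rewrite -mulrDl; exact: lexx.
rewrite le_eqVlt; apply/orP; left; apply/eqP; field.
by rewrite !lt0r_neq0//; lra.
Qed.

Lemma exceptional_limsup_negligible (R : realType) (d : R) : 0 < d ->
  (@lebesgue_measure R).-negligible
    [set x | forall J, exists2 j, (J <= j)%N & exceptional d j.+1 x].
Proof.
move=> d0; apply/negligible_outer_measure.
apply: (@outer_borel_cantelli R (fun j => exceptional d j.+1)
  (fun j => (96 ^+ 2 + 16 + 96 / d) * (j.+1%:R * Num.sqrt j.+1%:R)^-1) ((96 ^+ 2 + 16 + 96 / d) * 3)).
- by move=> j; exact: exceptional_le.
- move=> j; rewrite mulr_ge0 ?invr_ge0 ?mulr_ge0 ?sqrtr_ge0// addr_ge0//.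
  by rewrite divr_ge0// ltW.
- move=> N; rewrite -mulr_sumr ler_wpM2l//.
    by rewrite addr_ge0// divr_ge0// ltW.
  by have := sum_inv_x32_le R N; rewrite big_add1/= big_mkord.
Qed.

Lemma sum_sqr_le_sqr_sum (R : realDomainType) (f : nat -> R) (s : seq nat) :
  (forall k, 0 <= f k) -> \sum_(k <- s) f k ^+ 2 <= (\sum_(k <- s) f k) ^+ 2.
Proof.
move=> f0; elim: s => [|k s IH]; first by rewrite !big_nil expr0n.
have s0 : 0 <= \sum_(k <- s) f k by rewrite sumr_ge0.
rewrite !big_cons sqrrD; have := mulr_ge0 (f0 k) s0; nra.
Qed.

Lemma prime_digit_ratio_le (R : realType) (x d : R) n j : (0 < j)%N ->
  (4 ^ j <= n < 4 ^ j.+1)%N -> infinite_cf x -> ~ exceptional d j x ->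
  (\sum_(1 <= k < n.+1) cf_prime_digit k x)%N%:R
    / (\sum_(1 <= k < n.+1) cf_digit k x)%N%:R
  <= 48 * (116 / Num.sqrt j%:R + d ^+ 2) :> R.
Proof.
move=> j0 /andP[jn nj] ix nE.
have jR : 1 <= j%:R :> R by rewrite ler1n.
set r := Num.sqrt j%:R.
have rE : j%:R = r ^+ 2 by rewrite sqr_sqrtr.
have r0 : 0 < r by rewrite sqrtr_gt0 ltr0n.
have r1 : 1 <= r by rewrite rE in jR; nra.
set M : R := (4 ^ j)%:R; have M0 : 0 < M by rewrite ltr0n expn_gt0.
have S_ge : M * (j%:R / 48) <= (\sum_(1 <= k < n.+1) cf_digit k x)%N%:R.
  apply: (@le_trans _ _ (\sum_(1 <= k < (4 ^ j).+1) (cf_digit k x)%:R)).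
    by rewrite leNgt; apply/negP => /ltW h; apply: nE; left; left.
  rewrite natr_sum [leRHS](@big_cat_nat _ _ _ (4 ^ j).+1)//= lerDl sumr_ge0//.
set low := fun k => if prime (cf_digit k x) && (cf_digit k x < 4 ^ j)%N
  then (cf_digit k x)%:R else 0 : R.
set root := fun k => (large_prime_root j (cf_digit k x))%:R : R.
have low_le : \sum_(1 <= k < (4 ^ j.+1).+1) low k <= 2 * M * (8 + 50 * r).
  by rewrite leNgt; apply/negP => /ltW h; apply: nE; left; right.
have root_le : \sum_(1 <= k < (4 ^ j.+1).+1) root k <= (2 ^ j)%:R * (d * r).
  by rewrite leNgt; apply/negP => /ltW h; apply: nE; right.
have S'_le : (\sum_(1 <= k < n.+1) cf_prime_digit k x)%N%:R
    <= 2 * M * (8 + 50 * r) + M * (d * r) ^+ 2.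
  apply: (@le_trans _ _ (\sum_(1 <= k < (4 ^ j.+1).+1) (low k + root k ^+ 2))).
    rewrite natr_sum [leRHS](@big_cat_nat _ _ _ n.+1)//=; last by rewrite ltnS ltnW.
    rewrite -[leLHS]addr0; apply: lerD; last first.
      rewrite sumr_ge0// => k _; rewrite addr_ge0 ?exprn_ge0// /low.
      by case: ifP.
    apply: ler_sum => k _; rewrite /cf_prime_digit /low /root.
    case: ifP => [pk|_]/=; last by rewrite add0r exprn_ge0.
    case: ltnP => jk; first by rewrite lerDl exprn_ge0.
    by rewrite add0r -natrX ler_nat large_prime_root_sqr.
  rewrite big_split/=; apply: lerD => //.
  (* Large prime digits are at most the squares of their roots, and 2^j squares to M. *)
  apply: (le_trans (sum_sqr_le_sqr_sum _ _)) => //.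
  rewrite (_ : M * _ = ((2 ^ j)%:R * (d * r)) ^+ 2); last first.
    by rewrite [RHS]exprMn -natrX -expnM mulnC expnM.
  by rewrite ler_pXn2r ?nnegrE// ?sumr_ge0//; apply: le_trans root_le; rewrite sumr_ge0.
have S0 : 0 < (\sum_(1 <= k < n.+1) cf_digit k x)%N%:R :> R.
  by apply: lt_le_trans S_ge; rewrite mulr_gt0// divr_gt0//; lra.
rewrite ler_pdivrMr//; apply: (le_trans S'_le).
have c0 : 0 <= 48 * (116 / r + d ^+ 2).
  by rewrite mulr_ge0// addr_ge0 ?sqr_ge0// divr_ge0// ltW.
apply: (le_trans _ (ler_wpM2l c0 S_ge)).
(* The constant 116 absorbs 16 + 100 r, since r >= 1. *)
rewrite rE (_ : 48 * _ * _ = M * (116 * r + d ^+ 2 * r ^+ 2)); last by field; rewrite lt0r_neq0.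
rewrite (_ : 2 * _ * _ + _ = M * (16 + 100 * r + d ^+ 2 * r ^+ 2)); last by ring.
by rewrite ler_wpM2l ?(ltW M0)// lerD2r; lra.
Qed.

Theorem theorem2p8 (R : realType) :
  {ae (@lebesgue_measure R), forall x : R, x \in `]0, 1] ->
    (fun n : nat =>
       ((\sum_(1 <= k < n.+1) cf_prime_digit k x)%N%:R
        / (\sum_(1 <= k < n.+1) cf_digit k x)%N%:R : R)) @ \oo --> 0}.
Proof.
(* The tolerance runs through 1/(i + 1), so that the exceptional set is a countable union. *)
pose Z i := [set x | forall J, exists2 j, (J <= j)%N & exceptional (i.+1%:R^-1 : R) j.+1 x].
have null : (@lebesgue_measure R).-negligible (range (@ratr R) `|` \bigcup_i Z i).
  apply: negligibleU.
    by apply/negligible_outer_measure; exact: lebesgue_measure_rat.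
  apply: negligible_bigcup => i; apply: exceptional_limsup_negligible.
  by rewrite invr_gt0.
apply: negligibleS null => x nx.
apply: contrapT => /not_orP[nrat nZ]; apply: nx => x01.
have ix : infinite_cf x.
  apply: contrapT => /not_infinite_cf_rat h; apply: nrat; apply: h.
  by move: x01; rewrite inE/= in_itv.
apply/cvgrPdist_le => e e0.
pose i := Num.truncn (96 / e).
have ie : 48 * (i.+1%:R^-1) ^+ 2 <= e / 2.
  have := truncnS_gt (96 / e); rewrite -/i => ilt.
  have i1 : 1 <= i.+1%:R :> R by rewrite ler1n.
  rewrite ltr_pdivrMr// in ilt.
  rewrite exprVn ler_pdivrMr ?exprn_gt0//; nra.
have [J nJ] : exists J, forall j, (J <= j)%N -> ~ exceptional (i.+1%:R^-1 : R) j.+1 x.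
  apply: contrapT => h; apply: nZ; exists i => // J; apply: contrapT => h'.
  by apply: h; exists J => j Jj Ej; apply: h'; exists j.
(* 11136 = 2 * 48 * 116, so that the term in 1/r costs at most e/2. *)
pose K := Num.truncn (11136 / e).
have Ke r : K.+1%:R <= r -> 48 * (116 / r) <= e / 2.
  have := truncnS_gt (11136 / e); rewrite -/K => Klt Kr.
  have K1 : 1 <= K.+1%:R :> R by rewrite ler1n.
  rewrite ltr_pdivrMr// in Klt.
  rewrite mulrA ler_pdivrMr; [nra|lra].
near=> n.
(* This puts the scale of n past both J and (K + 1)^2; the latter makes its square root at least K +
   1. *)
have n0 : (4 ^ (maxn J (K.+1 ^ 2)).+1 <= n)%N by near: n; exists (4 ^ (maxn J (K.+1 ^ 2)).+1)%N.
have n1 : (0 < n)%N by apply: leq_trans n0; rewrite expn_gt0.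
have := @trunc_log_bounds 4 n isT n1; set j := trunc_log 4 n => nj.
have jJ : (maxn J (K.+1 ^ 2) < j)%N.
  by have /andP[_ h] := nj; have := leq_ltn_trans n0 h; rewrite ltn_exp2l.
case: j jJ nj => // j; rewrite ltnS geq_max => /andP[Jj Kj] nj.
rewrite sub0r normrN ger0_norm ?divr_ge0//.
apply: (le_trans (prime_digit_ratio_le _ nj ix (nJ _ Jj))) => //.
rewrite mulrDr (splitr e); apply: lerD => //.
apply: Ke; rewrite -[leLHS]ger0_norm// -sqrtr_sqr ler_wsqrtr//.
by rewrite -natrX ler_nat ltnW.
Unshelve. all: by end_near. Qed.
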